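(* Let $A$ be a finite-dimensional unimodular ribbon Hopf algebra over a field $k$ and let $[z]\in\hat Z^S(A)$. Then $[z]\in\mathcal T_Z$ if and only if for any $[a],[b]\in\hat Z(A)$, $$[z(a\star zb)]=[z(az\star b)].$$
   Context: $A=(A,m,\Delta,S,\epsilon,e)$ is a finite-dimensional Hopf algebra over a field $k$; Sweedler notation $\Delta(a)=\sum a_{(1)}\otimes a_{(2)}$. It is quasitriangular with $R$-matrix $R=\sum_i\alpha_i\otimes\beta_i$ (invertible, $T\Delta(a)=R\Delta(a)R^{-1}$ with $T$ the flip, $(\Delta\otimes1)R=R^{13}R^{23}$, $(1\otimes\Delta)R=R^{13}R^{12}$). Ribbon: $A$ is endowed with an invertible group-like element $g$ ($\Delta(g)=g\otimes g$) such that $S^2(a)=gag^{-1}$ for all $a$, and, with $u=\sum_i S(\beta_i)\alpha_i$, the central ribbon element $\theta=gu^{-1}=u^{-1}g$ satisfies $S(\theta)=\theta$. Unimodular: left and right integrals of $A$ coincide. $\Lambda\in A$ is an integral ($a\Lambda=\Lambda a=\epsilon(a)\Lambda$) and $\lambda\in A^*$ is a right integral for $A^*$ ($\sum\lambda(a_{(1)})a_{(2)}=\lambda(a)1$), with $\lambda(\Lambda)=1$. $a\star b=\sum_b\lambda(S(a)b_{(1)})b_{(2)}$. $Z(A)$ is the center; $K(A)=\{a\in Z(A)\mid\lambda(ab)=0\text{ for all }b\in Z(A)\}$; $\hat Z(A)=Z(A)/K(A)$; $[a]$ is the class of $a\in Z(A)$ in $\hat Z(A)$; $\hat Z^S(A)=\{[a]\mid[S(a)]=[a]\}$.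 Both the usual product and $\star$ descend to $\hat Z(A)$. $C^2=\{x\in A\otimes A\mid\Delta(b)x=x\Delta(b)\ \forall b\in A\}$; $C^2_Z\subset C^2$ is the commutative subalgebra generated by the elements $(a\otimes b)\Delta(c)$, $a,b,c\in Z(A)$. With $\mu(\sum_i a_i\otimes b_i,\sum_j c_j\otimes d_j)=\sum_{i,j}\lambda(a_ic_j)\lambda(b_id_j)$, put $\overline K^2_Z=\{x\in C^2_Z\mid\mu(x,y)=0\text{ for all }y\in C^2_Z\}$. Let $\delta(w,z)=z\otimes w-(1\otimes w)\Delta(z)\in C^2_Z$ for $w,z\in Z(A)$; the class of $\delta(w,z)$ in $C^2_Z/\overline K^2_Z$ depends only on $[w],[z]$. Then $\mathcal T_Z=\{[z]\in\hat Z^S(A)\mid\delta(z,z)\in\overline K^2_Z\}$. *)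

(* Defs.v *)
From HB Require Import structures.
From mathcomp Require Import all_boot all_order all_algebra all_field.
From mathcomp Require Import boolp.

Set Implicit Arguments.
Unset Strict Implicit.
Unset Printing Implicit Defensive.

Import GRing.Theory.
Local Open Scope ring_scope.

Declare Scope hopf_scope.
Delimit Scope hopf_scope with hopf.
Local Open Scope hopf_scope.

(* V \ox W is represented by coordinates on the products of the elements of   *)
(* the fixed bases vbasis {:V} and vbasis {:W}.                               *)
Definition tensor (k : fieldType) (V W : vectType k) : Type :=
  'M[k]_(\dim {:V}, \dim {:W}).
Arguments tensor {k} (V W)%_type.

Notation "V \ox W" := (tensor V W)
  (at level 40, left associativity) : type_scope.

HB.instance Definition _ (k : fieldType) (V W : vectType k) :=
  Vector.copy (V \ox W) 'M[k]_(\dim {:V}, \dim {:W}).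

Definition tens (k : fieldType) (V W : vectType k) (v : V) (w : W) : V \ox W :=
  \matrix_(i, j) (coord (vbasis {:V}) i v * coord (vbasis {:W}) j w).

Notation "v \ox w" := (tens v w)
  (at level 40, left associativity) : hopf_scope.

(* The linear map V \ox W -> U induced by f; it sends v \ox w to f v w only   *)
(* when f is bilinear (tlift_tens).                                           *)
Definition tlift (k : fieldType) (V W : vectType k) (U : lmodType k)
    (f : V -> W -> U) (x : V \ox W) : U :=
  \sum_i \sum_j (x : 'M_(_, _)) i j *: f (vbasis {:V})`_i (vbasis {:W})`_j.

(* Sweedler notation: with x = \sum_s v_s \ox w_s, this is \sum_s E(v_s, w_s) *)
(* whenever E is bilinear in (v, w).                                          *)
Notation "\sw_ ( v , w <- x ) E" := (tlift (fun v w => E) x)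
  (at level 41, E at level 41, v name, w name,
   format "\sw_ ( v ,  w  <-  x )  E") : hopf_scope.

Section TensorTheory.
Variables (k : fieldType) (V W : vectType k).

Lemma tens_linearl (w : W) : linear (fun v : V => v \ox w).
Proof.
by move=> a u v; apply/matrixP => i j; rewrite !mxE linearP mulrDl mulrA.
Qed.

Lemma tens_linearr (v : V) : linear (fun w : W => v \ox w).
Proof.
by move=> a u w; apply/matrixP => i j; rewrite !mxE linearP mulrDr mulrCA.
Qed.

Lemma tensZl a (v : V) (w : W) : (a *: v) \ox w = a *: (v \ox w).
Proof. by apply/matrixP => i j; rewrite !mxE linearZ mulrA. Qed.

Lemma tlift_linear (U : lmodType k) (f : V -> W -> U) : linear (tlift f).
Proof.
move=> a x y; rewrite /tlift scaler_sumr -big_split; apply: eq_bigr => i _.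
rewrite scaler_sumr -big_split; apply: eq_bigr => j _.
by rewrite /= !mxE scalerDl scalerA.
Qed.

HB.instance Definition _ (U : lmodType k) (f : V -> W -> U) :=
  GRing.isLinear.Build k (tensor V W) U *:%R (tlift f) (tlift_linear f).

Lemma tlift_linearf (T U : lmodType k) (F : V -> W -> T -> U) (x : V \ox W) :
    (forall v w, linear (F v w)) ->
  linear (fun t => \sw_(v, w <- x) F v w t).
Proof.
move=> Fl a s t; rewrite /tlift scaler_sumr -big_split; apply: eq_bigr => i _.
rewrite scaler_sumr -big_split; apply: eq_bigr => j _.
by rewrite /= Fl scalerDr !scalerA mulrC.
Qed.

Lemma tlift_tens (U : lmodType k) (f : V -> W -> U) (v : V) (w : W) :
    (forall w', linear (f^~ w')) -> (forall v', linear (f v')) ->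
  tlift f (v \ox w) = f v w.
Proof.
move=> fl fr.
pose F (w' : W) : {linear V -> U} :=
  HB.pack (f^~ w') (GRing.isLinear.Build k V U *:%R _ (fl w')).
pose G (v' : V) : {linear W -> U} :=
  HB.pack (f v') (GRing.isLinear.Build k W U *:%R _ (fr v')).
rewrite {2}(coord_vbasis (memvf v)) -[f _ w]/(F w _) linear_sum /tlift.
apply: eq_bigr => i _; rewrite linearZ /=.
rewrite {2}(coord_vbasis (memvf w)) -[f _ _ in RHS]/(G _ _) linear_sum.
rewrite scaler_sumr; apply: eq_bigr => j _.
by rewrite linearZ scalerA mxE.
Qed.

Lemma tensor_sum (x : V \ox W) : x = \sw_(v, w <- x) v \ox w.
Proof.
pose m : 'M[k]_(_, _) := x.
pose t (i : 'I_(\dim {:V})) (j : 'I_(\dim {:W})) : 'M[k]_(_, _) :=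
  m i j *: ((vbasis {:V})`_i \ox (vbasis {:W})`_j : 'M[k]_(_, _)).
suff: m = \sum_i \sum_j t i j by [].
have freeb := basis_free (vbasisP _).
have tE i j i' j' : t i j i' j' = m i j * ((i == i')%:R * (j == j')%:R).
  by rewrite !mxE !coord_free ?freeb.
apply/matrixP => i j; rewrite summxE.
under eq_bigr => i' _ do rewrite summxE.
rewrite pair_big /= (bigD1 (i, j)) //= tE !eqxx !mulr1 big1 ?addr0 //.
case=> i' j' /= /negPf; rewrite xpair_eqE tE => ij.
by rewrite -natrM mulnb ij mulr0.
Qed.

Lemma tensor_ind (P : V \ox W -> Prop) :
    P 0 -> (forall x y, P x -> P y -> P (x + y)) ->
    (forall v w, P (v \ox w)) ->
  forall x, P x.
Proof.
move=> P0 PD Pt x; rewrite (tensor_sum x).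
apply: (big_ind P) => // i _; apply: (big_ind P) => // j _.
by rewrite -tensZl.
Qed.
End TensorTheory.

Section TensorAlgebra.
Variables (k : fieldType) (A B : falgType k).
Implicit Types x y z : A \ox B.

Definition tens_one : A \ox B := 1 \ox 1.
Definition tens_mul x y : A \ox B :=
  \sw_(a, b <- x) \sw_(c, d <- y) (a * c) \ox (b * d).

Lemma tens_mul_linearl y : linear (tens_mul^~ y).
Proof. exact: tlift_linear. Qed.

Lemma tens_mul_linearr x : linear (tens_mul x).
Proof.
by apply: tlift_linearf => a b; apply: tlift_linear.
Qed.

Let mulD x y z : tens_mul x (y + z) = tens_mul x y + tens_mul x z.
Proof. by rewrite -[y]scale1r tens_mul_linearr !scale1r. Qed.

Let Dmul x y z : tens_mul (x + y) z = tens_mul x z + tens_mul y z.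
Proof. by rewrite -[x]scale1r tens_mul_linearl !scale1r. Qed.

Let mul0 x : tens_mul x 0 = 0.
Proof. by apply: (addrI (tens_mul x 0)); rewrite -mulD !addr0. Qed.

Let mul0t x : tens_mul 0 x = 0.
Proof. by apply: (addrI (tens_mul 0 x)); rewrite -Dmul !addr0. Qed.

Lemma tens_mulE (a c : A) (b d : B) :
  tens_mul (a \ox b) (c \ox d) = (a * c) \ox (b * d).
Proof.
rewrite /tens_mul tlift_tens => [|w'|v'].
- rewrite tlift_tens // => [w' e v v'|v' e w w'].
    by rewrite mulrDr -scalerAr tens_linearl.
  by rewrite mulrDr -scalerAr tens_linearr.
- apply: tlift_linearf => v w e u u'.
  by rewrite mulrDl -scalerAl tens_linearl.
apply: tlift_linearf => v w e u u'.
by rewrite mulrDl -scalerAl tens_linearr.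
Qed.

Fact tens_mulA : associative tens_mul.
Proof.
move=> x y z; elim/tensor_ind: x => [|x x' ex ex'|a b]; rewrite ?mul0t //.
  by rewrite !Dmul ex ex'.
elim/tensor_ind: y => [|y y' ey ey'|c d]; first by rewrite ?(mul0t, mul0).
  by rewrite !(mulD, Dmul) ey ey'.
elim/tensor_ind: z => [|z z' ez ez'|e f]; first by rewrite ?(mul0t, mul0).
  by rewrite !(mulD, Dmul) ez ez'.
by rewrite !tens_mulE !mulrA.
Qed.

Fact tens_mul1 : left_id tens_one tens_mul.
Proof.
move=> x; elim/tensor_ind: x => [|x x' ex ex'|a b]; first by rewrite mul0.
  by rewrite mulD ex ex'.
by rewrite /tens_one tens_mulE !mul1r.
Qed.

Fact tens_mulr1 : right_id tens_one tens_mul.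
Proof.
move=> x; elim/tensor_ind: x => [|x x' ex ex'|a b]; first by rewrite mul0t.
  by rewrite Dmul ex ex'.
by rewrite /tens_one tens_mulE !mulr1.
Qed.

Fact tens_one_neq0 : tens_one != 0.
Proof.
have nz (C : falgType k) : exists i, coord (vbasis {:C}) i 1 != 0.
  apply/existsP; apply: contraNT (oner_neq0 C); rewrite negb_exists.
  move/forallP => h; rewrite (coord_vbasis (memvf (1 : C))) big1 // => i _.
  by move/negPn/eqP: (h i) => ->; rewrite scale0r.
have [[i ai] [j bj]] := (nz A, nz B).
apply/eqP => /matrixP/(_ i j); rewrite !mxE => /eqP.
by rewrite mulf_eq0 (negPf ai) (negPf bj).
Qed.

HB.instance Definition _ := GRing.Zmodule_isNzRing.Build (tensor A B)
  tens_mulA tens_mul1 tens_mulr1 Dmul (fun x y z => mulD x y z) tens_one_neq0.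

Fact tens_scaleAl (c : k) x y : c *: (x * y) = c *: x * y.
Proof.
by have := tens_mul_linearl y c x 0; rewrite mul0t !addr0.
Qed.

HB.instance Definition _ :=
  GRing.Lmodule_isLalgebra.Build k (tensor A B) tens_scaleAl.

Fact tens_scaleAr (c : k) x y : c *: (x * y) = x * (c *: y).
Proof.
by have := tens_mul_linearr x c y 0; rewrite mul0 !addr0.
Qed.

HB.instance Definition _ :=
  GRing.Lalgebra_isAlgebra.Build k (tensor A B) tens_scaleAr.

HB.instance Definition _ := Algebra_isFalgebra.Build k (tensor A B).
End TensorAlgebra.

Lemma tensM (k : fieldType) (A B : falgType k) (a c : A) (b d : B) :
  (a \ox b) * (c \ox d) = (a * c) \ox (b * d).
Proof. exact: tens_mulE. Qed.

Section TensorMaps.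
Variables (k : fieldType).

Definition tmap (V V' W W' : vectType k) (f : V -> V') (g : W -> W')
    (x : V \ox W) : V' \ox W' :=
  \sw_(v, w <- x) f v \ox g w.

Definition tflip (V W : vectType k) (x : V \ox W) : W \ox V :=
  \sw_(v, w <- x) w \ox v.

Definition tassoc (U V W : vectType k) (x : U \ox (V \ox W)) : U \ox V \ox W :=
  \sw_(u, y <- x) \sw_(v, w <- y) u \ox v \ox w.
End TensorMaps.

HB.mixin Record isHopfAlgebra (k : fieldType) A of Falgebra k A := {
  comul : 'AHom(A, tensor A A);
  counit : 'AHom(A, k^o);
  antipode : 'End(A);
  comulA : forall a : A,
    tmap comul id (comul a) = tassoc (tmap id comul (comul a));
  counitl : forall a : A, \sw_(a1, a2 <- comul a) ((counit a1 : k) *: a2) = a;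
  counitr : forall a : A, \sw_(a1, a2 <- comul a) ((counit a2 : k) *: a1) = a;
  antipodel : forall a : A,
    \sw_(a1, a2 <- comul a) (antipode a1 * a2) = (counit a : k) *: 1;
  antipoder : forall a : A,
    \sw_(a1, a2 <- comul a) (a1 * antipode a2) = (counit a : k) *: 1
}.

#[short(type="hopfAlgType")]
HB.structure Definition HopfAlgebra (k : fieldType) :=
  {A of isHopfAlgebra k A & Falgebra k A}.

Section Hopf.
Variables (k : fieldType) (A : hopfAlgType k).

Local Notation Z := 'Z({:A})%VS.
Local Notation S := (@antipode k A).
Local Notation Delta := (@comul k A).
Local Notation eps := (@counit k A).

Section Ribbon.
Variables (R : A \ox A) (g : A).

Definition R12 : A \ox A \ox A := R \ox 1.
Definition R13 : A \ox A \ox A := \sw_(a, b <- R) a \ox 1 \ox b.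
Definition R23 : A \ox A \ox A := \sw_(a, b <- R) 1 \ox a \ox b.

Record quasitriangular : Prop := Quasitriangular {
  Rmatrix_unit : R \is a GRing.unit;
  Rmatrix_flip : forall a : A, tflip (Delta a) = R * Delta a * R^-1;
  Rmatrix_comull : tmap Delta id R = R13 * R23;
  Rmatrix_comulr : tassoc (tmap id Delta R) = R13 * R12
}.

Definition drinfeld : A := \sw_(a, b <- R) (S b * a).

Definition ribbon_elt : A := g * drinfeld^-1.

(* Invertibility of drinfeld, and commutation and centrality of ribbon_elt,   *)
(* follow from the other fields; they are recorded so that drinfeld^-1 is     *)
(* visibly an inverse (x^-1 = x when x is not a unit).                        *)
Record ribbon : Prop := Ribbon {
  ribbon_quasitriangular :> quasitriangular;
  ribbon_unit : g \is a GRing.unit;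
  ribbon_grouplike : Delta g = g \ox g;
  ribbon_antipode2 : forall a : A, S (S a) = g * a * g^-1;
  ribbon_drinfeld_unit : drinfeld \is a GRing.unit;
  ribbon_eltC : ribbon_elt = drinfeld^-1 * g;
  ribbon_elt_center : ribbon_elt \in Z;
  ribbon_elt_antipode : S ribbon_elt = ribbon_elt
}.
End Ribbon.

Definition left_integral (x : A) : Prop :=
  forall a : A, a * x = (eps a : k) *: x.
Definition right_integral (x : A) : Prop :=
  forall a : A, x * a = (eps a : k) *: x.

Definition unimodular : Prop := forall x, left_integral x <-> right_integral x.

(* lam is a right integral for the dual Hopf algebra A^*.                     *)
Definition right_cointegral (lam : 'Hom(A, k^o)) : Prop :=
  forall a : A, \sw_(a1, a2 <- Delta a) ((lam a1 : k) *: a2) = (lam a : k) *: 1.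

Section Zhat.
Variable lam : 'Hom(A, k^o).

Definition star (a b : A) : A :=
  \sw_(b1, b2 <- Delta b) ((lam (S a * b1) : k) *: b2).

Definition KZ : {pred A} :=
  [pred a | (a \in Z) && `[< forall b, b \in Z -> lam (a * b) = 0 >]].

Lemma KZP a :
  reflect (a \in Z /\ forall b, b \in Z -> lam (a * b) = 0) (a \in KZ).
Proof.
apply: (iffP andP) => -[aZ ab]; split=> //.
  by move/asboolP: ab.
exact/asboolP.
Qed.

Fact KZ_zmod_closed : zmod_closed KZ.
Proof.
split=> [|a b /KZP[aZ a0] /KZP[bZ b0]]; apply/KZP; split.
- exact: mem0v.
- by move=> b _; rewrite mul0r linear0.
- exact: memvB.
by move=> c cZ; rewrite mulrBl linearB /= a0 // b0 // subr0.
Qed.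

HB.instance Definition _ := GRing.isZmodClosed.Build A KZ KZ_zmod_closed.

(* The ambient quotient A / K(A); the space Z(A) / K(A) is the image in it    *)
(* of the center, i.e. the set of the classes cls z with z \in Z(A).          *)
Definition Aquo : Type := Quotient.quot KZ.
HB.instance Definition _ := GRing.Zmodule.on Aquo.

Definition cls (a : A) : Aquo := (\pi_(Quotient.quot KZ) a)%qT.

Lemma clsP a b : cls a = cls b <-> a - b \in KZ.
Proof.
rewrite /cls; split => [/eqP|]; first by rewrite -Quotient.idealrBE.
by rewrite Quotient.idealrBE => /eqP.
Qed.

Definition ZhatS (c : Aquo) : Prop :=
  exists a, [/\ a \in Z, c = cls a & cls (S a) = cls a].

(* An {aspace _} may have a unit other than 1, but 1 is one of the generators *)
(* (take a = b = c = 1), so all the subalgebras intersected here are unital.  *)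
Definition C2Z (x : A \ox A) : Prop :=
  forall U : {aspace tensor A A},
    (forall a b c, a \in Z -> b \in Z -> c \in Z ->
       (a \ox b) * Delta c \in U) ->
  x \in U.

Definition mu (x y : A \ox A) : k :=
  \sw_(a, b <- x) \sw_(c, d <- y) (lam (a * c) * lam (b * d)).

Definition K2Z (x : A \ox A) : Prop :=
  C2Z x /\ forall y, C2Z y -> mu x y = 0.

Definition delta (w z : A) : A \ox A := z \ox w - (1 \ox w) * Delta z.

Definition TZ (c : Aquo) : Prop :=
  exists z, [/\ z \in Z, c = cls z, ZhatS (cls z) & K2Z (delta z z)].
End Zhat.
End Hopf.

Arguments ribbon {k A} R g.
Arguments unimodular {k} A.

(* Main.v *)
(* Put t(a, b, c) = (lam \ox lam)((a \ox b) Delta(c)).  Both conditions say    *)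
(*   t(z a, z b, c) = t(a, z b, z c)  for all central a, b, c,                *)
(* and t vanishes on central arguments one of which is in K(A), so that z may *)
(* be replaced by S(z) or by another representative of its class.             *)
(* The vanishing follows from                                                 *)
(*   (lam \ox id)((a \ox 1) Delta(c)) central             for the slot b;     *)
(*   t(a, b, c) = t(b, a, c), by the R-matrix             for the slot a;     *)
(*   t(a, b, c) = lam(w c), w = a1 lam(b S^-1(a2)) central for the slot c.    *)
(* Centrality rests on lam(x y) = lam(S^2(y) x) and on the identities         *)
(*   1 \ox x = (S(x1) \ox 1) Delta(x2) = Delta(x2) (S^-1(x1) \ox 1),          *)
(*   x \ox 1 = Delta(x1) (1 \ox S(x2)) = (1 \ox S^-1(x2)) Delta(x1).          *)

From HB Require Import structures.
Require Import Defs.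
From mathcomp Require Import all_boot all_order all_algebra all_field.

Set Implicit Arguments.
Unset Strict Implicit.
Unset Printing Implicit Defensive.

Import GRing.Theory.
Local Open Scope ring_scope.
Local Open Scope hopf_scope.

(** Both conditions are statements about one trilinear form on the center, t(a, b, c) =
    [lam2 ((a \ox b) * Delta c)]. Central a \ox b commute with all of A \ox A and [Delta] is
    multiplicative, so the generators of [C2Z] already span it. Orthogonality of [delta z z] to
    [C2Z] therefore amounts to t(za, zb, c) = t(a, zb, zc) for central a, b, c ([C2Z_linear_ind],
    [K2Z_delta]). Equality of classes in Z(A)/K(A) is tested by pairing with central elements, and
    pairing z(a star b) with c gives t(S a, zc, b) ([lam_star]). The star identity is thus the same
    equation with S a in place of a, once S z is replaced by z ([star_balanced]). That replacement,
    and the change of representative of [z], are legitimate because t descends to the quotient in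
    each argument ([eq_lam2_comul]). The descent rests on Radford's formula [lam_twist], which makes
    partial evaluations of t central, and on the R-matrix, which makes t symmetric in its first two
    arguments ([lam2_comul_sym]). *)

Ltac lin :=
  move=> ? ? ?; repeat first [ rewrite tens_linearl | rewrite tens_linearr
  | rewrite linearP | rewrite mulrDl | rewrite mulrDr | rewrite -scalerAl
  | rewrite -scalerAr ]; done.

(** * Linearity and exchange rules for Sweedler sums *)

Section TensorLift.
Variables (k : fieldType) (V W : vectType k).

Lemma eq_tlift (U : lmodType k) (f f' : V -> W -> U) (x : V \ox W) :
  (forall v w, f v w = f' v w) -> tlift f x = tlift f' x.
Proof. by move=> e; do 2!apply: eq_bigr => ? _; rewrite e. Qed.

Lemma linear_tlift (U U' : lmodType k) (h : U -> U') (f : V -> W -> U)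
    (x : V \ox W) :
  linear h -> h (tlift f x) = tlift (fun v w => h (f v w)) x.
Proof.
move=> hl; pose h' : {linear U -> U'} :=
  HB.pack h (GRing.isLinear.Build k U U' *:%R _ hl).
rewrite -[h _]/(h' _) linear_sum; apply: eq_bigr => i _.
by rewrite linear_sum; apply: eq_bigr => j _; rewrite linearZ.
Qed.

Lemma tlift_exchange (V' W' : vectType k) (U : lmodType k)
    (f : V -> W -> V' -> W' -> U) (x : V \ox W) (y : V' \ox W') :
  \sw_(a, b <- x) \sw_(c, d <- y) f a b c d =
  \sw_(c, d <- y) \sw_(a, b <- x) f a b c d.
Proof.
have scale2 (I I' : finType) c (F : I -> I' -> U) :
    c *: (\sum_i \sum_i' F i i') = \sum_i \sum_i' c *: F i i'.
  by rewrite scaler_sumr; apply: eq_bigr => i _; rewrite scaler_sumr.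
rewrite /tlift; under eq_bigr => i _ do under eq_bigr => j _ do rewrite scale2.
under [RHS]eq_bigr => i _ do under eq_bigr => j _ do rewrite scale2.
rewrite pair_big exchange_big [RHS]pair_big.
under eq_bigr do rewrite exchange_big.
rewrite pair_big [LHS]/=; apply: eq_bigr => -[c d] _.
rewrite [RHS]pair_big; apply: eq_bigr => -[a b] _.
by rewrite !scalerA mulrC.
Qed.

Lemma tensZr a (v : V) (w : W) : v \ox (a *: w) = a *: (v \ox w).
Proof. by apply/matrixP => i j; rewrite !mxE linearZ mulrCA. Qed.

Lemma tensDl (v v' : V) (w : W) : (v + v') \ox w = v \ox w + v' \ox w.
Proof. by rewrite -[v]scale1r tens_linearl !scale1r. Qed.

Lemma tensDr (v : V) (w w' : W) : v \ox (w + w') = v \ox w + v \ox w'.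
Proof. by rewrite -[w]scale1r tens_linearr !scale1r. Qed.

End TensorLift.

(** * Coassociativity and the antipode *)

Section HopfTheory.
Variables (k : fieldType) (A : hopfAlgType k).
Implicit Types (a b c x y : A) (X Y : A \ox A).

Local Notation S := (@antipode k A).
Local Notation Delta := (@comul k A).
Local Notation eps := (@counit k A).

Lemma mul_tlift (U V : vectType k) (B : falgType k) (f : U -> V -> B) (r : B)
    (x : U \ox V) :
  r * tlift f x = \sw_(v, w <- x) (r * f v w).
Proof. by apply: (linear_tlift (h := fun u => r * u)); lin. Qed.

Lemma tlift_mul (U V : vectType k) (B : falgType k) (f : U -> V -> B) (r : B)
    (x : U \ox V) :
  tlift f x * r = \sw_(v, w <- x) (f v w * r).
Proof. by apply: (linear_tlift (h := fun u => u * r)); lin. Qed.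

Lemma scaler_tlift (V W : vectType k) (U : lmodType k) (f : V -> W -> U) e
    (x : V \ox W) :
  e *: tlift f x = \sw_(v, w <- x) (e *: f v w).
Proof.
apply: (linear_tlift (h := fun u => e *: u)) => a u v.
by rewrite scalerDr !scalerA mulrC.
Qed.

(** Apply the map induced by [F] on the triple tensor product to both sides of [comulA]. *)
Lemma comul_coassoc (U : lmodType k) (F : A -> A -> A -> U) x :
    (forall q r, linear (fun p => F p q r)) ->
    (forall p r, linear (fun q => F p q r)) ->
    (forall p q, linear (F p q)) ->
  \sw_(x1, x2 <- Delta x) \sw_(p, q <- Delta x1) F p q x2 =
  \sw_(x1, x2 <- Delta x) \sw_(p, q <- Delta x2) F x1 p q.
Proof.
move=> F1 F2 F3; pose F' X r : U := \sw_(p, q <- X) F p q r.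
have F'l r : linear (F'^~ r) by exact: tlift_linear.
have F'r X : linear (F' X) by exact: tlift_linearf.
have := congr1 (tlift F') (comulA x).
rewrite /tmap /tassoc (linear_tlift _ _ (@tlift_linear _ _ _ _ _)).
under eq_tlift => a b do rewrite tlift_tens //.
move=> ->; rewrite !(linear_tlift _ _ (@tlift_linear _ _ _ _ _)).
apply: eq_tlift => a b; rewrite tlift_tens. 
- rewrite (linear_tlift _ _ (@tlift_linear _ _ _ _ _)).
  apply: eq_tlift => p q; rewrite tlift_tens // /F' tlift_tens //.
- have tl w : linear (fun u : A => \sw_(p, q <- w) (u \ox p \ox q)).
    apply: (tlift_linearf (F := fun p q u => u \ox p \ox q)) => p q.
    by move=> e u v; rewrite !tens_linearl.
  by move=> w e u v; rewrite tl; apply: tlift_linear.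
by move=> v e u w; rewrite tlift_linear; apply: tlift_linear.
Qed.

Let comul_tens x : \sw_(a, b <- Delta x) a \ox b = Delta x.
Proof. by rewrite -tensor_sum. Qed.

(** Write x as eps(x1) x2, replace eps(x1) 1 by the antipode axiom, and reassociate. *)
Lemma tens1_comul x :
  1 \ox x = \sw_(x1, x2 <- Delta x) ((S x1 \ox 1) * Delta x2).
Proof.
transitivity (\sw_(x1, x2 <- Delta x) \sw_(p, q <- Delta x1) (S p * q) \ox x2).
  rewrite -{1}[x](counitl x) (linear_tlift _ _ (tens_linearr (1 : A))).
  apply: eq_tlift => a b.
  rewrite -(linear_tlift _ _ (@tens_linearl k A A b)) antipodel.
  by rewrite tensZl tensZr.
rewrite comul_coassoc; [|by move=> *; lin..].
apply: eq_tlift => a b; rewrite -[in RHS](comul_tens b) mul_tlift.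
by apply: eq_tlift => p q; rewrite tensM mul1r.
Qed.

Lemma tensl1_comul x :
  x \ox 1 = \sw_(x1, x2 <- Delta x) (Delta x1 * (1 \ox S x2)).
Proof.
transitivity (\sw_(x1, x2 <- Delta x) \sw_(p, q <- Delta x2) x1 \ox (p * S q)).
  rewrite -{1}[x](counitr x) (linear_tlift _ _ (@tens_linearl k A A 1)).
  apply: eq_tlift => a b.
  rewrite -(linear_tlift _ _ (tens_linearr a)) antipoder.
  by rewrite tensZl tensZr.
rewrite -comul_coassoc; [|by move=> *; lin..].
apply: eq_tlift => a b; rewrite -[in RHS](comul_tens a) tlift_mul.
by apply: eq_tlift => p q; rewrite tensM mulr1.
Qed.

Lemma antipode1 : S 1 = 1.
Proof.
have := antipodel (1 : A).
rewrite rmorph1 tlift_tens ?rmorph1 ?mulr1 ?scale1r // => [b|b].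
  by lin.
by lin.
Qed.

(** The map [M] (multiplication after id \ox S) is left linear over A \ox 1, sends 1 \ox c to S c
    and collapses [Delta c] to the counit. Expanding 1 \ox y by [tens1_comul] inside M((1 \ox x)(1
    \ox y)) then yields the reversed product. *)
Lemma antipodeM x y : S (x * y) = S y * S x.
Proof.
pose M (X : A \ox A) := \sw_(p, q <- X) (p * S q).
have Ml p X : M ((p \ox 1) * X) = p * M X.
  elim/tensor_ind: X => [|X Y eX eY|a b]; rewrite ?mulr0 /M ?linear0 ?mulr0 //.
    by rewrite mulrDr !linearD /= -!/(M _) eX eY mulrDr.
  by rewrite tensM mul1r !tlift_tens ?mulrA // => ?; lin.
have Mc c : M (Delta c) = (eps c : k) *: 1 by exact: antipoder.
have Sx c : S c = \sw_(c1, c2 <- Delta c) ((eps c2 : k) *: S c1).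
  rewrite -{1}[c]counitr (linear_tlift _ _ (linearP S)).
  by apply: eq_tlift => a b; rewrite linearZ.
have M1 c : M (1 \ox c) = S c by rewrite /M tlift_tens ?mul1r // => ?; lin.
rewrite -M1.
have MxD z c : M ((1 \ox z) * Delta c) = (eps c : k) *: S z.
  rewrite tens1_comul tlift_mul /M (linear_tlift _ _ (@tlift_linear _ _ _ _ _)).
  rewrite Sx scaler_tlift; apply: eq_tlift => a b; rewrite -/(M _).
  rewrite -mulrA Ml -rmorphM Mc rmorphM /= -scalerAr mulr1 scalerA.
  by rewrite mulrC.
have -> : (1 : A) \ox (x * y) = (1 \ox x) * (1 \ox y) by rewrite tensM mul1r.
rewrite (tens1_comul y) mul_tlift /M.
rewrite (linear_tlift _ _ (@tlift_linear _ _ _ _ _)).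
rewrite [S y]Sx tlift_mul; apply: eq_tlift => y1 y2; rewrite -/(M _).
have -> : (1 \ox x) * ((S y1 \ox 1) * Delta y2) =
          (S y1 \ox 1) * ((1 \ox x) * Delta y2).
  by rewrite !mulrA !tensM !mulr1 !mul1r.
by rewrite Ml MxD -scalerAl -scalerAr.
Qed.
End HopfTheory.

(** * The inverse of the antipode and its straightening identities *)

Section AntipodeInverse.
Variables (k : fieldType) (A : hopfAlgType k) (T : A -> A).
Implicit Types (a b c x y : A) (X Y : A \ox A).

Local Notation S := (@antipode k A).
Local Notation Delta := (@comul k A).
Local Notation eps := (@counit k A).

Hypotheses (TK : cancel T S) (SK : cancel S T).

Lemma antipodeV_linear : linear T.
Proof. exact: can2_linear SK TK. Qed.

Lemma antipodeVM x y : T (x * y) = T y * T x.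
Proof. by apply: (can_inj SK); rewrite antipodeM !TK. Qed.

Lemma antipodeVl x :
  \sw_(x1, x2 <- Delta x) (T x2 * x1) = (eps x : k) *: 1.
Proof.
apply: (can_inj SK); rewrite (linear_tlift _ _ (linearP S)).
rewrite [RHS]linearZ /= antipode1.
by rewrite -antipodel; apply: eq_tlift => a b; rewrite antipodeM TK.
Qed.

Lemma antipodeVr x :
  \sw_(x1, x2 <- Delta x) (x2 * T x1) = (eps x : k) *: 1.
Proof.
apply: (can_inj SK); rewrite (linear_tlift _ _ (linearP S)).
rewrite [RHS]linearZ /= antipode1.
by rewrite -antipoder; apply: eq_tlift => a b; rewrite antipodeM TK.
Qed.

Let comul_tens x : \sw_(a, b <- Delta x) a \ox b = Delta x.
Proof. by rewrite -tensor_sum. Qed.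

Ltac linT := move=> ? ? ?; repeat first [ rewrite antipodeV_linear
  | rewrite tens_linearl | rewrite tens_linearr | rewrite mulrDl
  | rewrite mulrDr | rewrite -scalerAl | rewrite -scalerAr ]; done.

Lemma tensl1_comulV x :
  x \ox 1 = \sw_(x1, x2 <- Delta x) ((1 \ox T x2) * Delta x1).
Proof.
transitivity (\sw_(x1, x2 <- Delta x) \sw_(p, q <- Delta x2) x1 \ox (T q * p)).
  rewrite -{1}[x](counitr x) (linear_tlift _ _ (@tens_linearl k A A 1)).
  apply: eq_tlift => a b.
  by rewrite -(linear_tlift _ _ (tens_linearr a)) antipodeVl tensZl tensZr.
rewrite -(comul_coassoc (F := fun p q r => p \ox (T r * q)));
  [|by move=> *; linT..].
apply: eq_tlift => a b; rewrite -[in RHS](comul_tens a) mul_tlift.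
by apply: eq_tlift => p q; rewrite tensM mul1r.
Qed.

Lemma tens1_comulV x :
  1 \ox x = \sw_(x1, x2 <- Delta x) (Delta x2 * (T x1 \ox 1)).
Proof.
transitivity (\sw_(x1, x2 <- Delta x) \sw_(p, q <- Delta x1) (q * T p) \ox x2).
  rewrite -{1}[x](counitl x) (linear_tlift _ _ (tens_linearr (1 : A))).
  apply: eq_tlift => a b.
  rewrite -(linear_tlift _ _ (@tens_linearl k A A b)) antipodeVr.
  by rewrite tensZl tensZr.
rewrite (comul_coassoc (F := fun p q r => (q * T p) \ox r));
  [|by move=> *; linT..].
apply: eq_tlift => a b; rewrite -[in RHS](comul_tens b) tlift_mul.
by apply: eq_tlift => p q; rewrite tensM mulr1.
Qed.

End AntipodeInverse.

(** * Integrals and the Nakayama automorphism of the cointegral *)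

Section Cointegral.
Variables (k : fieldType) (A : hopfAlgType k) (lam : 'Hom(A, k^o)).
Implicit Types (a b c x y : A) (X Y : A \ox A).

Local Notation S := (@antipode k A).
Local Notation Delta := (@comul k A).

Lemma tens1C x y : (x \ox 1) * (1 \ox y) = (1 \ox y) * (x \ox 1) :> A \ox A.
Proof. by rewrite !tensM !mulr1 !mul1r. Qed.

Lemma comulZ e x : Delta (e *: x) = e *: Delta x.
Proof. exact: linearZ. Qed.

Lemma comulM x y : Delta (x * y) = Delta x * Delta y.
Proof. exact: rmorphM. Qed.

Definition contractl X : A := \sw_(a, b <- X) ((lam a : k) *: b).

HB.instance Definition _ := GRing.isLinear.Build k (A \ox A)%type A *:%R
  contractl (tlift_linear _).

Lemma contractl_tens a b : contractl (a \ox b) = (lam a : k) *: b.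
Proof.
rewrite /contractl tlift_tens // => [c|c] e u v.
  by rewrite linearP scalerDl scalerA.
by rewrite scalerDr !scalerA mulrC.
Qed.

Lemma contractl_mulr X y : contractl (X * (1 \ox y)) = contractl X * y.
Proof.
elim/tensor_ind: X => [|X Y eX eY|a b]; first by rewrite mul0r !linear0 mul0r.
  by rewrite mulrDl !linearD /= eX eY mulrDl.
by rewrite tensM !contractl_tens mulr1 scalerAl.
Qed.

Lemma contractl_mull X y : contractl ((1 \ox y) * X) = y * contractl X.
Proof.
elim/tensor_ind: X => [|X Y eX eY|a b]; first by rewrite mulr0 !linear0 mulr0.
  by rewrite mulrDr !linearD /= eX eY mulrDr.
by rewrite tensM !contractl_tens mul1r scalerAr.
Qed.

Lemma starE a b : star lam a b = contractl ((S a \ox 1) * Delta b).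
Proof.
rewrite /star {2}(tensor_sum (Delta b)) mul_tlift.
rewrite (linear_tlift _ _ (linearP contractl)); apply: eq_tlift => p q /=.
by rewrite tensM contractl_tens mul1r.
Qed.

Variables (T : A -> A) (Lam : A).
Hypotheses (TK : cancel T S) (SK : cancel S T).
Hypotheses (lam_right : right_cointegral lam).
Hypotheses (Lam_left : left_integral Lam) (Lam_right : right_integral Lam).
Hypothesis lam_Lam : lam Lam = 1.

Lemma contractl_comul c : contractl (Delta c) = (lam c : k) *: 1.
Proof. exact: (lam_right c). Qed.

(** After [tens1_comul], Delta(x2) Delta(Lam) = Delta(x2 Lam) = eps(x2) Delta(Lam). *)
Lemma comul_integrall x :
  (1 \ox x) * Delta Lam = (S x \ox 1) * Delta Lam.
Proof.
rewrite tens1_comul tlift_mul -{2}[x]counitr (linear_tlift _ _ (linearP S)).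
rewrite (linear_tlift _ _ (@tens_linearl k A A 1)) tlift_mul.
apply: eq_tlift => a b; rewrite -mulrA -comulM Lam_left comulZ linearZ /=.
by rewrite tensZl -scalerAl -scalerAr.
Qed.

Lemma comul_integralr x :
  Delta Lam * (x \ox 1) = Delta Lam * (1 \ox S x).
Proof.
rewrite tensl1_comul mul_tlift -{2}[x]counitl (linear_tlift _ _ (linearP S)).
rewrite (linear_tlift _ _ (@tens_linearr k A A 1)) mul_tlift.
apply: eq_tlift => a b; rewrite mulrA -comulM Lam_right comulZ linearZ /=.
by rewrite tensZr -scalerAl -scalerAr.
Qed.

Lemma contractl_integral : contractl (Delta Lam) = 1.
Proof. by rewrite contractl_comul lam_Lam scale1r. Qed.

(** Left multiplication produces the inverse antipode, right multiplication the antipode; this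
    discrepancy is the source of S^2 in [lam_twist]. *)
Lemma contractl_integrall y : contractl ((y \ox 1) * Delta Lam) = T y.
Proof.
by rewrite -{1}[y]TK -comul_integrall contractl_mull contractl_integral mulr1.
Qed.

Lemma contractl_integralr y : contractl (Delta Lam * (y \ox 1)) = S y.
Proof.
by rewrite comul_integralr contractl_mulr contractl_integral mul1r.
Qed.

Let contractr X : A := \sw_(a, b <- X) ((lam (S b) : k) *: a).

(** A double sum over two copies of [Delta Lam] is evaluated in both orders: one inner sum gives S c
    by [contractl_integralr], the other S (T a) = a by [contractl_integrall]. *)
Let contractr_integral : contractr (Delta Lam) = 1.
Proof.
apply: (can_inj SK); rewrite antipode1 /contractr.
rewrite (linear_tlift _ _ (linearP S)).
transitivity (\sw_(c, d <- Delta Lam) \sw_(a, b <- Delta Lam)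
                (((lam (S d) : k) * (lam (a * c) : k)) *: b)).
  apply: eq_tlift => c d; rewrite linearZ /=.
  rewrite -(contractl_integralr c) [in LHS](tensor_sum (Delta Lam)) tlift_mul.
  rewrite (linear_tlift _ _ (linearP contractl)) scaler_tlift.
  by apply: eq_tlift => a b; rewrite /= tensM mulr1 contractl_tens scalerA.
rewrite tlift_exchange -contractl_integral; apply: eq_tlift => a b.
rewrite -{2}(TK a) -contractl_integrall.
rewrite [in RHS](tensor_sum (Delta Lam)) mul_tlift.
rewrite (linear_tlift _ _ (linearP contractl)).
rewrite (linear_tlift _ _ (linearP S)) (linear_tlift _ _ (linearP lam)).
have sl : linear (fun e : k^o => (e : k) *: b).
  by move=> e u v; rewrite scalerDl scalerA.
rewrite (linear_tlift _ _ sl); apply: eq_tlift => c d.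
by rewrite /= tensM mul1r contractl_tens !linearZ /= mulrC.
Qed.

(* Radford's theorem on unimodular Hopf algebras: [S^2] is the Nakayama       *)
(* automorphism of [lam]; every element has the form [L1 f(L2)], where        *)
(* [L1 \ox L2 = Delta Lam].                                                   *)
Lemma lam_twist x y : lam (x * y) = lam (S (S y) * x).
Proof.
have cl X w : lam (w * contractr X) = lam (S (contractl ((w \ox 1) * X))).
  rewrite /contractr mul_tlift [in RHS](tensor_sum X) mul_tlift.
  rewrite (linear_tlift _ _ (linearP contractl)).
  rewrite (linear_tlift _ _ (linearP S)) !(linear_tlift _ _ (linearP lam)).
  apply: eq_tlift => c d.
  by rewrite /= tensM mul1r contractl_tens -scalerAr !linearZ /= [RHS]mulrC.
have cr X w : lam (contractr X * w) = lam (S (contractl (X * (w \ox 1)))).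
  rewrite /contractr tlift_mul [in RHS](tensor_sum X) tlift_mul.
  rewrite (linear_tlift _ _ (linearP contractl)).
  rewrite (linear_tlift _ _ (linearP S)) !(linear_tlift _ _ (linearP lam)).
  apply: eq_tlift => c d.
  by rewrite /= tensM mulr1 contractl_tens -scalerAl !linearZ /= [RHS]mulrC.
have -> : x = contractr ((1 \ox T x) * Delta Lam).
  rewrite comul_integrall TK -{1}[x]mulr1 -[in LHS]contractr_integral.
  rewrite /contractr.
  rewrite mul_tlift [in RHS](tensor_sum (Delta Lam)) mul_tlift.
  rewrite (linear_tlift _ _ (@tlift_linear _ _ _ _ _)).
  apply: eq_tlift => c d; rewrite tensM mul1r tlift_tens ?scalerAr // => b.
    by move=> e u v; rewrite scalerDr !scalerA mulrC.
  by move=> e u v; rewrite !linearP scalerDl scalerA.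
(* Both sides become [lam (S (T x * S y))]. *)
rewrite cl cr mulrA tens1C -!mulrA !contractl_mull contractl_integralr.
by rewrite contractl_integrall SK.
Qed.

End Cointegral.

(** * Central elements and the span of the generators of [C2Z] *)

Section CentralSubalgebra.
Variables (k : fieldType) (A : hopfAlgType k).
Implicit Types (a b c x : A) (X Y : A \ox A).

Local Notation Delta := (@comul k A).
Local Notation Z := 'Z({:A})%VS.

Lemma centerP a : reflect (forall x, a * x = x * a) (a \in Z).
Proof.
rewrite memv_cap memvf; apply: (iffP centvP) => h x; first exact/h/memvf.
by move=> _; apply: h.
Qed.

Lemma center_mul a b : a \in Z -> b \in Z -> a * b \in Z.
Proof. exact: memvM. Qed.

Lemma center1 : (1 : A) \in Z.
Proof. by apply/centerP => x; rewrite mul1r mulr1. Qed.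

Lemma tens_center a b X : a \in Z -> b \in Z ->
  (a \ox b) * X = X * (a \ox b).
Proof.
move=> /centerP aC /centerP bC.
elim/tensor_ind: X => [|X Y eX eY|p q]; first by rewrite mulr0 mul0r.
  by rewrite mulrDr mulrDl eX eY.
by rewrite !tensM aC bC.
Qed.

Lemma tflip_tens a b : tflip (a \ox b) = b \ox a.
Proof. by rewrite /tflip tlift_tens // => c; lin. Qed.

Lemma tflip_mul X Y : tflip (X * Y) = tflip X * tflip Y.
Proof.
have fD (U V : A \ox A) : tflip (U + V) = tflip U + tflip V by exact: linearD.
have f0 : tflip (0 : A \ox A) = 0 by exact: linear0.
elim/tensor_ind: X => [|X X' eX eX'|a b]; first by rewrite !(mul0r, f0).
  by rewrite mulrDl !fD eX eX' mulrDl.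
elim/tensor_ind: Y => [|Y Y' eY eY'|c d]; first by rewrite !(mulr0, f0).
  by rewrite mulrDr !fD eY eY' mulrDr.
by rewrite !(tensM, tflip_tens).
Qed.

Lemma linear_span_mem (V W : vectType k) (f : V -> W) (U : {vspace W})
    (s : seq V) :
    linear f -> (forall v, v \in s -> f v \in U) ->
  forall v, v \in <<s>>%VS -> f v \in U.
Proof.
move=> fl sU v; pose h : {linear V -> W} :=
  HB.pack f (GRing.isLinear.Build k V W *:%R _ fl).
have hE u : f u = linfun h u by rewrite lfunE.
suff /subvP sub : (<<s>> <= linfun h @^-1: U)%VS.
  by move=> /sub; rewrite -memv_preim -hE.
by apply/span_subvP => u /sU; rewrite -memv_preim -hE.
Qed.

Let B := vbasis Z.
(** Basis vectors of the center suffice by trilinearity, and keep the family finite so that its span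
    is a [vspace]. *)
Let gens : seq (A \ox A) :=
  [seq X * Delta c | X <- [seq a \ox b | a <- B, b <- B], c <- B].

Let mem_gens a b c : a \in Z -> b \in Z -> c \in Z ->
  (a \ox b) * Delta c \in <<gens>>%VS.
Proof.
have spanB : <<B>>%VS = Z := span_basis (vbasisP Z).
rewrite -!spanB => aB bB cB.
move: a aB; apply: linear_span_mem => [|a aB]; first by lin.
move: b bB; apply: linear_span_mem => [|b bB]; first by lin.
move: c cB; apply: linear_span_mem => [|c cB].
  by move=> e u v; rewrite linearP mulrDr -scalerAr.
by apply/memv_span/allpairs_f => //; apply: allpairs_f.
Qed.

Let gensP X : X \in gens -> exists a b c,
  [/\ a \in Z, b \in Z, c \in Z & X = (a \ox b) * Delta c].
Proof.
case/allpairsP=> -[Y c] /= [/allpairsP[[a b] /= [aB bB ->]] cB ->].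
by exists a, b, c; split => //; apply: vbasis_mem.
Qed.

(* The elements of [a \ox b] with [a], [b] central commute with [Delta c], so *)
(* the span of the generators of [C2Z] is already a subalgebra.               *)
Lemma C2Z_linear_ind (W : {vspace (A \ox A)%type}) :
    (forall a b c, a \in Z -> b \in Z -> c \in Z ->
       (a \ox b) * Delta c \in W) ->
  forall X, C2Z X -> X \in W.
Proof.
move=> gW X C2X.
have closed : is_aspace <<gens>>%VS.
  apply/andP; split.
    apply: has_algid1; rewrite -[1]mulr1 -[X in _ * X](rmorph1 Delta).
    exact: mem_gens center1 center1 center1.
  apply/prodvP => u v uU vU.
  move: u uU; apply: linear_span_mem => [|u /gensP[a [b [c [aZ bZ cZ ->]]]]].
    by lin.
  move: v vU; apply: linear_span_mem => [|v]; first by lin.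
  case/gensP=> a' [b' [c' [aZ' bZ' cZ' ->]]].
  rewrite -mulrA (mulrA (Delta c)) -(tens_center (Delta c) aZ' bZ') -!mulrA.
  by rewrite -comulM mulrA tensM mem_gens ?center_mul.
have /subvP : (<<gens>> <= W)%VS.
  by apply/span_subvP => _ /gensP[a [b [c [aZ bZ cZ ->]]]]; apply: gW.
by apply; apply: (C2X (ASpace closed)); exact: mem_gens.
Qed.
End CentralSubalgebra.

(** * The trilinear form on the center of a ribbon Hopf algebra *)

Section Ribbon.
Variables (k : fieldType) (A : hopfAlgType k) (R : (A \ox A)%type) (g : A).
Variables (Lam : A) (lam : 'Hom(A, k^o)).
Implicit Types (a b c x y z : A) (X Y : A \ox A).

Local Notation S := (@antipode k A).
Local Notation Delta := (@comul k A).
Local Notation Z := 'Z({:A})%VS.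
Local Notation contractl := (contractl lam).
Local Notation KZ := (KZ lam).

Hypothesis ribbonA : ribbon R g.
Hypotheses (Lam_left : left_integral Lam) (Lam_right : right_integral Lam).
Hypothesis lam_right : right_cointegral lam.
Hypothesis lam_Lam : lam Lam = 1.

(** The inverse of [S], read off from S^2 being conjugation by [g]. *)
Let T a : A := S (g^-1 * a * g).

Let TK : cancel T S.
Proof.
move=> a; have gu := ribbon_unit ribbonA.
by rewrite /T (ribbon_antipode2 ribbonA) -!mulrA divrr // mulr1 mulVKr.
Qed.

Let SK : cancel S T.
Proof.
have gu := ribbon_unit ribbonA.
have S_inj : injective S.
  have S2K : cancel (fun a => S (S a)) (fun a => g^-1 * a * g).
    move=> a; rewrite /= (ribbon_antipode2 ribbonA) !mulrA mulVr //.
    by rewrite mul1r mulrVK.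
  by move=> a b e; apply: (can_inj S2K); rewrite e.
by move=> a; apply: S_inj; rewrite TK.
Qed.

Let TT a : T (T a) = g^-1 * a * g.
Proof.
by apply: (can_inj SK); rewrite TK.
Qed.

Lemma center_antipode2 a : a \in Z -> S (S a) = a.
Proof.
move/centerP=> aZ; have gu := ribbon_unit ribbonA.
by rewrite (ribbon_antipode2 ribbonA) -aZ mulrK.
Qed.

Lemma center_antipodeV a : a \in Z -> T a = S a.
Proof. by move=> aZ; rewrite -{1}(center_antipode2 aZ) SK. Qed.

Lemma center_antipode a : a \in Z -> S a \in Z.
Proof.
move/centerP=> aZ; apply/centerP => x.
by rewrite -[x]TK -!antipodeM aZ.
Qed.

Lemma lam_twistV x y : lam (x * y) = lam (y * T (T x)).
Proof.
rewrite (lam_twist TK SK lam_right Lam_left Lam_right lam_Lam y).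
by rewrite !TK.
Qed.

Lemma contractl_twist u X :
  contractl ((u \ox 1) * X) = contractl (X * (T (T u) \ox 1)).
Proof.
elim/tensor_ind: X => [|X Y eX eY|p q]; first by rewrite mulr0 mul0r.
  by rewrite mulrDr mulrDl !linearD /= eX eY.
by rewrite !tensM !contractl_tens mul1r mulr1 lam_twistV.
Qed.

(** Multiplying by x on the right or on the left is expanded by [tens1_comulV] or [tens1_comul]. The
    factor S x1 on the left turns into T x1 on the right by [contractl_twist], and Delta(x2) passes
    through since a and c are central. *)
Lemma contractl_center a c : a \in Z -> c \in Z ->
  contractl ((a \ox 1) * Delta c) \in Z.
Proof.
move=> aZ /centerP cC; apply/centerP => x.
rewrite -contractl_mulr -contractl_mull.
rewrite {1}(tens1_comulV TK SK) tens1_comul mul_tlift tlift_mul.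
rewrite !(linear_tlift _ _ (linearP contractl)); apply: eq_tlift => p q /=.
transitivity (contractl ((S p \ox 1) * ((a \ox 1) * Delta c * Delta q))).
  by rewrite contractl_twist SK !mulrA.
congr contractl; rewrite -[in LHS](mulrA (a \ox 1)) -comulM cC comulM.
rewrite -!mulrA [in RHS](mulrA (Delta q)).
by rewrite -(tens_center (Delta q) aZ (center1 A)) !mulrA.
Qed.

Definition lam2 X : k := lam (contractl X).

Lemma lam2_tens a b : lam2 (a \ox b) = (lam a : k) * (lam b : k).
Proof. by rewrite /lam2 contractl_tens linearZ. Qed.

Lemma lam2B X Y : lam2 (X - Y) = lam2 X - lam2 Y.
Proof. by rewrite /lam2 !linearB. Qed.

Lemma lam2D X Y : lam2 (X + Y) = lam2 X + lam2 Y.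
Proof. by rewrite /lam2 !linearD. Qed.

Lemma muE X Y : mu lam X Y = lam2 (X * Y).
Proof.
rewrite [in RHS](tensor_sum X) [in RHS](tensor_sum Y) tlift_mul /lam2 /mu.
rewrite (linear_tlift _ _ (linearP contractl)).
rewrite (linear_tlift _ _ (linearP lam)).
apply: (@eq_tlift _ _ _ k^o) => a b /=.
rewrite mul_tlift (linear_tlift _ _ (linearP contractl)).
rewrite (linear_tlift _ _ (linearP lam)); apply: (@eq_tlift _ _ _ k^o) => c d.
by rewrite /= tensM contractl_tens linearZ.
Qed.

(** The inverse Nakayama automorphism acts on each leg as conjugation by the inverse of [g]. *)
Lemma lam2_twist X Y :
  lam2 (X * Y) = lam2 (Y * ((g^-1 \ox g^-1) * X * (g \ox g))).
Proof.
elim/tensor_ind: X => [|X X' eX eX'|a b]; first by rewrite !(mul0r, mulr0).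
  by rewrite !(mulrDl, mulrDr) !lam2D eX eX'.
elim/tensor_ind: Y => [|Y Y' eY eY'|c d]; first by rewrite !(mul0r, mulr0).
  by rewrite mulrDr mulrDl !lam2D eY eY'.
by rewrite !tensM !lam2_tens -!TT -!lam_twistV.
Qed.

Lemma lam2_flip X : lam2 (tflip X) = lam2 X.
Proof.
rewrite [in RHS](tensor_sum X) /lam2 /tflip.
rewrite !(linear_tlift _ _ (linearP contractl)).
rewrite !(linear_tlift _ _ (linearP lam)).
apply: (@eq_tlift _ _ _ k^o) => a b /=.
by rewrite -[LHS]/(lam2 _) -[RHS]/(lam2 _) !lam2_tens mulrC.
Qed.

(* [lam (g * _)] is a trace and [g] is group-like, so conjugation by [R] which  *)
(* relates [Delta] to its flip is invisible to [lam2] on central elements.    *)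
Lemma lam2_comul_sym a b c : a \in Z -> b \in Z ->
  lam2 ((a \ox b) * Delta c) = lam2 ((b \ox a) * Delta c).
Proof.
move=> aZ bZ; have Ru := Rmatrix_unit ribbonA; have gu := ribbon_unit ribbonA.
(* The flip fixes [Delta g], so [R] commutes with it. *)
have gR : (g \ox g) * R = R * (g \ox g).
  have := Rmatrix_flip ribbonA g; rewrite (ribbon_grouplike ribbonA).
  by rewrite tflip_tens => {1}->; rewrite mulrVK.
rewrite -[RHS]lam2_flip tflip_mul tflip_tens (Rmatrix_flip ribbonA).
rewrite -[R * _ * _]mulrA [in RHS]mulrA (tens_center R aZ bZ) -[in RHS]mulrA.
rewrite [RHS]lam2_twist -[_ * R * _]mulrA -gR [in RHS](mulrA (g^-1 \ox g^-1)).
by rewrite tensM mulVr // mul1r -!mulrA mulVr // mulr1.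
Qed.

(** * Descent of the form to the quotient by K(A) *)

Lemma lam2_comul_Kr a b c : a \in Z -> b \in KZ -> c \in Z ->
  lam2 ((a \ox b) * Delta c) = 0.
Proof.
move=> aZ /KZP[bZ b0] cZ; rewrite /lam2.
have -> : a \ox b = (1 \ox b) * (a \ox 1) by rewrite tensM mulr1 mul1r.
by rewrite -mulrA contractl_mull b0 // contractl_center.
Qed.

Lemma lam2_comul_Kl a b c : a \in KZ -> b \in Z -> c \in Z ->
  lam2 ((a \ox b) * Delta c) = 0.
Proof.
move=> aK bZ cZ; rewrite lam2_comul_sym ?lam2_comul_Kr //.
by case/KZP: aK.
Qed.

(** At X = [Delta a] this is the element representing t(a, b, _) through [lam]. *)
Let contractT b X : A := \sw_(p, q <- X) ((lam (b * T q) : k) *: p).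

Let contractT_linear b : linear (contractT b).
Proof. exact: tlift_linear. Qed.

Let T_linear : linear T.
Proof. exact: antipodeV_linear TK SK. Qed.

Let contractT_tens b p q : contractT b (p \ox q) = (lam (b * T q) : k) *: p.
Proof.
rewrite /contractT tlift_tens // => c e u v.
  by rewrite scalerDr !scalerA mulrC.
by rewrite T_linear mulrDr -scalerAr linearP scalerDl scalerA.
Qed.

Let contractT_center a b : a \in Z -> b \in Z -> contractT b (Delta a) \in Z.
Proof.
move=> /centerP aC bZ; apply/centerP => x; move/centerP: (bZ) => bC.
pose K : {linear (A \ox A)%type -> A} :=
  HB.pack (contractT b)
    (GRing.isLinear.Build k (A \ox A)%type A *:%R _ (contractT_linear b)).
have KE X : contractT b X = K X by [].
have Kt := contractT_tens b.
have Kl X : K ((x \ox 1) * X) = x * K X.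
  elim/tensor_ind: X => [|X Y eX eY|p q]; first by rewrite mulr0 !linear0 mulr0.
    by rewrite mulrDr !linearD eX eY mulrDr.
  by rewrite tensM mul1r -!KE !Kt scalerAr.
have Kr X : K (X * (x \ox 1)) = K X * x.
  elim/tensor_ind: X => [|X Y eX eY|p q]; first by rewrite mul0r !linear0 mul0r.
    by rewrite mulrDl !linearD eX eY mulrDl.
  by rewrite tensM mulr1 -!KE !Kt scalerAl.
(* This carries the second-leg factor of [tensl1_comulV] over to that of [tensl1_comul]; it uses
   [lam_twistV] and the centrality of b. *)
have KT u X : K ((1 \ox T u) * X) = K (X * (1 \ox S u)).
  elim/tensor_ind: X => [|X Y eX eY|p q]; first by rewrite mulr0 mul0r.
    by rewrite mulrDr mulrDl !linearD eX eY.
  rewrite !tensM mulr1 mul1r -!KE !Kt !(antipodeVM TK SK) SK.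
  congr (_ *: _); rewrite [in RHS]mulrA (bC u) -[in RHS]mulrA.
  by rewrite [RHS]lam_twistV mulrA.
rewrite KE -Kl -Kr {1}(tensl1_comul x) (tensl1_comulV TK SK).
rewrite tlift_mul mul_tlift.
rewrite !(linear_tlift _ _ (linearP K)); apply: eq_tlift => p q /=.
by rewrite -[RHS]/(K _) -[LHS]/(K _) -[in RHS]mulrA KT !mulrA -!comulM aC.
Qed.

(** Straightening a \ox 1 merges the coproducts into Delta(a1 c), which the cointegral property
    collapses. This isolates c, as [lam2_comul_K] requires. *)
Lemma contractl_comulE a c :
  contractl ((a \ox 1) * Delta c) =
  \sw_(a1, a2 <- Delta a) ((lam (a1 * c) : k) *: T a2).
Proof.
rewrite (tensl1_comulV TK SK) tlift_mul (linear_tlift _ _ (linearP contractl)).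
apply: eq_tlift => p q /=.
rewrite -mulrA -comulM contractl_mull (contractl_comul lam_right).
by rewrite -scalerAr mulr1.
Qed.

Lemma lam2_comul_K a b c : a \in Z -> b \in Z -> c \in KZ ->
  lam2 ((a \ox b) * Delta c) = 0.
Proof.
move=> aZ bZ /KZP[/centerP cC c0].
have <- : lam (c * contractT b (Delta a)) = lam2 ((a \ox b) * Delta c).
  have -> : a \ox b = (1 \ox b) * (a \ox 1) by rewrite tensM mulr1 mul1r.
  rewrite /lam2 -mulrA contractl_mull contractl_comulE cC /contractT.
  rewrite tlift_mul mul_tlift !(linear_tlift _ _ (linearP lam)).
  apply: eq_tlift => p q /=.
  by rewrite -scalerAl -scalerAr !linearZ; apply: mulrC.
exact/c0/contractT_center.
Qed.

(* For central [b], [lam (S a * b) = lam2 ((a \ox b) * Delta Lam)]. *)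
Lemma KZ_antipode a : a \in KZ -> S a \in KZ.
Proof.
move=> aK; have [aZ _] := KZP _ _ aK; apply/KZP.
split=> [|b bZ]; first exact: center_antipode.
have LamZ : Lam \in Z by apply/centerP => x; rewrite Lam_left Lam_right.
rewrite -(lam2_comul_Kl aK bZ LamZ) /lam2.
have -> : a \ox b = (1 \ox b) * (a \ox 1) by rewrite tensM mulr1 mul1r.
rewrite -mulrA contractl_mull.
rewrite (contractl_integrall TK lam_right Lam_left lam_Lam).
by rewrite center_antipodeV //; move/centerP: bZ => ->.
Qed.

Lemma KZ_mul a b : a \in KZ -> b \in Z -> a * b \in KZ.
Proof.
move=> /KZP[aZ a0] bZ; apply/KZP; split=> [|c cZ]; first exact: center_mul.
by rewrite -mulrA a0 // center_mul.
Qed.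

Lemma eq_lam2_comul a a' b b' c c' :
    a \in Z -> a' \in Z -> b \in Z -> b' \in Z -> c \in Z -> c' \in Z ->
    a - a' \in KZ -> b - b' \in KZ -> c - c' \in KZ ->
  lam2 ((a \ox b) * Delta c) = lam2 ((a' \ox b') * Delta c').
Proof.
move=> aZ aZ' bZ bZ' cZ cZ' aK bK cK.
transitivity (lam2 ((a' \ox b) * Delta c)).
  apply/eqP; rewrite -subr_eq0 -lam2B -mulrBl; apply/eqP.
  have -> : a \ox b - a' \ox b = (a - a') \ox b.
    by rewrite tensDl -[- a']scaleN1r tensZl scaleN1r.
  exact: lam2_comul_Kl.
transitivity (lam2 ((a' \ox b') * Delta c)).
  apply/eqP; rewrite -subr_eq0 -lam2B -mulrBl; apply/eqP.
  have -> : a' \ox b - a' \ox b' = a' \ox (b - b').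
    by rewrite tensDr -[- b']scaleN1r tensZr scaleN1r.
  exact: lam2_comul_Kr.
apply/eqP; rewrite -subr_eq0 -lam2B -mulrBr -linearB; apply/eqP.
exact: lam2_comul_K.
Qed.

(* [delta z z] is orthogonal to the generators of [C2Z]. *)
Definition balanced z : Prop := forall a b c, a \in Z -> b \in Z -> c \in Z ->
  lam2 (((z * a) \ox (z * b)) * Delta c) =
  lam2 ((a \ox (z * b)) * Delta (z * c)).

Lemma balanced_cls z z' : z \in Z -> z' \in Z -> z - z' \in KZ ->
  balanced z -> balanced z'.
Proof.
move=> zZ zZ' zK bal a b c aZ bZ cZ.
have K0 x : x - x \in KZ by rewrite subrr; apply: rpred0.
have zM x : x \in Z -> z * x - z' * x \in KZ.
  by move=> xZ; rewrite -mulrBl KZ_mul.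
have := bal a b c aZ bZ cZ.
rewrite (@eq_lam2_comul _ (z' * a) _ (z' * b) _ c) ?center_mul ?zM //.
by rewrite (@eq_lam2_comul a a (z * b) (z' * b) _ (z' * c)) ?center_mul ?zM.
Qed.

Lemma K2Z_delta z : z \in Z -> K2Z lam (delta z z) <-> balanced z.
Proof.
move=> zZ.
have E a b c : a \in Z -> b \in Z ->
    lam2 (delta z z * ((a \ox b) * Delta c)) =
    lam2 (((z * a) \ox (z * b)) * Delta c) -
    lam2 ((a \ox (z * b)) * Delta (z * c)).
  move=> aZ bZ; rewrite /delta mulrBl lam2B mulrA tensM comulM.
  rewrite [in X in _ - X]mulrA -[in X in _ - X](mulrA (1 \ox z)).
  by rewrite -(tens_center (Delta z) aZ bZ) !mulrA tensM mul1r.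
split=> [[_ K0] a b c aZ bZ cZ | bal].
  apply/eqP; rewrite -subr_eq0 -E // -muE; apply/eqP/K0 => U; exact.
split=> [U gU | Y].
  rewrite memvB //; last exact: (gU _ _ _ (center1 A) zZ zZ).
  by have := gU _ _ _ zZ zZ (center1 A); rewrite rmorph1 mulr1.
have mul : linear (fun X => lam2 (delta z z * X) : k^o).
  by move=> e u v; rewrite /lam2 mulrDr -scalerAr !linearP.
pose h : {linear (A \ox A)%type -> k^o} :=
  HB.pack (fun X => lam2 (delta z z * X) : k^o)
    (GRing.isLinear.Build k (A \ox A)%type k^o *:%R _ mul).
move=> /(C2Z_linear_ind (W := lker (linfun h))) Y0.
rewrite muE; suff: Y \in lker (linfun h) by rewrite memv_ker lfunE => /eqP.
apply: Y0 => a b c aZ bZ cZ; rewrite memv_ker lfunE /=.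
by rewrite E // bal // subrr.
Qed.

(** * The star product in terms of the trilinear form *)

Lemma star_center a b : a \in Z -> b \in Z -> star lam a b \in Z.
Proof.
by move=> aZ bZ; rewrite starE contractl_center ?center_antipode.
Qed.

Lemma lam_star a b c z : a \in Z -> b \in Z -> c \in Z -> z \in Z ->
  lam (z * star lam a b * c) = lam2 ((S a \ox (z * c)) * Delta b).
Proof.
move=> aZ bZ /centerP cC zZ; rewrite /lam2.
have -> : S a \ox (z * c) = (1 \ox (z * c)) * (S a \ox 1).
  by rewrite tensM mulr1 mul1r.
rewrite -[in RHS]mulrA contractl_mull -starE -mulrA.
by rewrite -(cC (star lam a b)) mulrA.
Qed.

(** Pairing with c gives t(S a, zc, zb) on one side and t(S(z) S(a), zc, b) on the other. Modulo
    K(A), S z may be replaced by z, which leaves [balanced] at S a, c, b. *)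
Lemma star_balanced z : z \in Z -> S z - z \in KZ ->
  balanced z <->
  (forall a b, a \in Z -> b \in Z ->
     cls lam (z * star lam a (z * b)) = cls lam (z * star lam (a * z) b)).
Proof.
move=> zZ zK.
have K0 x : x - x \in KZ by rewrite subrr; apply: rpred0.
have lhs a b c : a \in Z -> b \in Z -> c \in Z ->
    lam (z * star lam a (z * b) * c) = lam2 ((S a \ox (z * c)) * Delta (z * b)).
  by move=> aZ bZ cZ; rewrite lam_star ?center_mul.
have rhs a b c : a \in Z -> b \in Z -> c \in Z ->
    lam (z * star lam (a * z) b * c) =
    lam2 (((z * S a) \ox (z * c)) * Delta b).
  move=> aZ bZ cZ; rewrite lam_star ?center_mul // antipodeM.
  apply: eq_lam2_comul; rewrite ?center_mul ?center_antipode //.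
  by rewrite -mulrBl KZ_mul ?center_antipode.
split=> [bal a b aZ bZ | eqc a b c aZ bZ cZ].
  apply/clsP/KZP; split=> [|c cZ].
    by rewrite memvB ?center_mul ?star_center ?center_mul.
  by rewrite mulrBl linearB /= lhs // rhs // bal ?center_antipode // subrr.
(* Every central a is S of the central element S a, since S^2 is the identity on the center. *)
have SaZ := center_antipode aZ.
have /clsP/KZP[_ /(_ b bZ)] := eqc (S a) c SaZ cZ.
rewrite mulrBl linearB /= lhs // rhs // center_antipode2 // => /eqP.
by rewrite subr_eq0 => /eqP.
Qed.

(** [ZhatS] provides S-invariance for some representative only; stability of K(A) under S transfers
    it to z. *)
Lemma ZhatS_antipode z : z \in Z -> ZhatS (cls lam z) -> S z - z \in KZ.
Proof.
move=> zZ [a [aZ /clsP zaK /clsP aK]].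
have -> : S z - z = S (z - a) + (S a - a) - (z - a).
  by rewrite linearB /= addrA subrK opprB addrA subrK.
by apply: rpredB => //; apply: rpredD => //; apply: KZ_antipode.
Qed.

End Ribbon.

Theorem proposition2p6 (k : fieldType) (A : hopfAlgType k)
    (R : (A \ox A)%type) (g : A) (Lam : A) (lam : 'Hom(A, k^o)) (z : A)
    (ribbonA : ribbon R g) (unimodA : unimodular A)
    (Lam_left : left_integral Lam) (Lam_right : right_integral Lam)
    (lam_right : right_cointegral lam) (lam_Lam : lam Lam = 1)
    (zZ : z \in 'Z({:A})%VS) (zS : ZhatS (cls lam z)) :
  TZ (cls lam z) <->
  (forall a b : A, a \in 'Z({:A})%VS -> b \in 'Z({:A})%VS ->
     cls lam (z * star lam a (z * b)) = cls lam (z * star lam (a * z) b)).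
Proof.
have zK : antipode z - z \in KZ lam by apply: ZhatS_antipode; eassumption.
rewrite -(star_balanced ribbonA Lam_left Lam_right lam_right lam_Lam zZ zK).
split=> [[z' [zZ' /clsP zzK _]] | bal].
  move/(K2Z_delta _ zZ').
  (* [TZ] speaks of some representative z', so [balanced] has to be carried from z' to z. *)
  apply: balanced_cls; try eassumption.
  by rewrite -opprB rpredN.
by exists z; split=> //; apply/K2Z_delta.
Qed.
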